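(* Let $\lambda$ be an integer partition. Then $$\mathrm{rev}\circ \zeta \circ \mathrm{rev} \circ \zeta^{-1} \circ \mathrm{rev}\, (\pi_\lambda^{\mathrm{Inv}}) = \pi_\lambda^{\mathrm{Quinv}} .$$
   Context: A Dyck path of semilength $n$ is a lattice path from $(0,0)$ to $(n,n)$ made of $n$ unit north steps $N$ and $n$ unit east steps $E$ staying weakly above the diagonal $x=y$; it is written as a word in $N,E$. Unit cells of the $n\times n$ grid are named by the coordinates $(i,j)$ (column $i$, row $j$) of their north-east corner. Let $h_i$ be the number of $N$ steps before the $i$-th $E$ step. $\mathrm{Area}(\pi)$ is the set of cells below $\pi$ and strictly above the diagonal: $\mathrm{Area}(\pi)=\{(i,j): 1\le i\le n,\ i<j\le h_i\}$. A Dyck path of given semilength is determined by its Area. The reversal map $\mathrm{rev}$ on Dyck paths reads the word of the path from right to left and interchanges $E$ and $N$. The map $\zeta$ on Dyck paths: for a Dyck path $\pi$ of semilength $n$, consider the $n$ cells immediately to the right of the $N$ steps of $\pi$ (the diagonal of a cell $(x,y)$ is $y-x$). Give these cells reading labels $1,\ldots,n$: first label the cells in the lowest diagonal ($y-x=0$) from left to right, then those in the second lowest diagonal from left to right, and so on. The box with label $i$ dinv-attacks the box with label $j$, written $\boxed{i}\rightarrow\boxed{j}$, if either $i<j$ and the two boxes are in the same diagonal, or the box labelled $j$ is exactly one diagonal above that of the box labelled $i$ and lies strictly to its left (smaller column). Then $\zeta(\pi)$ is the Dyck path of semilength $n$ with $\mathrm{Area}(\zeta(\pi))=\{(i,j):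 \boxed{i}\rightarrow\boxed{j}\text{ in }\pi\}$. It is known that $\zeta$ is a well-defined bijection on Dyck paths of semilength $n$; $\zeta^{-1}$ is its inverse. For a partition $\lambda=(\lambda_1\ge\cdots\ge\lambda_\ell>0)$ define the Dyck paths of semilength $|\lambda|$ $$\pi_\lambda^{\mathrm{Inv}} = N^{\lambda_\ell}\cdot(EN)^{\lambda_\ell} N^{\lambda_{\ell-1}-\lambda_{\ell}}\cdot(EN)^{\lambda_{\ell-1}} N^{\lambda_{\ell-2}-\lambda_{\ell-1}} \cdots (EN)^{\lambda_2} N^{\lambda_1-\lambda_2} \cdot E^{\lambda_1},$$ $$\pi_\lambda^{\mathrm{Quinv}} = N^{\lambda_\ell}\cdot N^{\lambda_{\ell-1}-\lambda_{\ell}}(EN)^{\lambda_\ell} \cdot N^{\lambda_{\ell-2}-\lambda_{\ell-1}}(EN)^{\lambda_{\ell-1}} \cdots N^{\lambda_1-\lambda_2}(EN)^{\lambda_2} \cdot E^{\lambda_1}.$$ *)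

(* Defs.v *)
(* All indices are 0-based: the cell (i, j) : 'I_n * 'I_n is the unit cell whose
   north-east corner is (i+1, j+1), and label i : 'I_n is the reading label i+1. *)
From HB Require Import structures.
From mathcomp Require Import all_boot.
From mathcomp Require Import zify.

Set Implicit Arguments.
Unset Strict Implicit.
Unset Printing Implicit Defensive.

Definition North : bool := true.
Definition East : bool := false.

Definition above_diag (w : seq bool) : bool :=
  all (fun k => count_mem East (take k w) <= count_mem North (take k w))
      (iota 0 (size w).+1).

Definition is_dyck (n : nat) (w : seq bool) : bool :=
  [&& count_mem North w == n, count_mem East w == n & above_diag w].

Record dyck (n : nat) : predArgType :=
  Dyck { dyck_word :> n.*2.-tuple bool; dyck_wordP : is_dyck n dyck_word }.

HB.instance Definition _ n := [isSub for @dyck_word n].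
HB.instance Definition _ n := [Finite of dyck n by <:].

Lemma count_NE (w : seq bool) : count_mem North w + count_mem East w = size w.
Proof. by elim: w => //= -[] w /=; rewrite /North /East => <-; lia. Qed.

Lemma is_dyck_size n w : is_dyck n w -> size w == n.*2.
Proof. by case/and3P=> /eqP a /eqP b _; rewrite -count_NE a b addnn. Qed.

Definition mk_dyck n (w : seq bool) (hw : is_dyck n w) : dyck n :=
  @Dyck n (Tuple (is_dyck_size hw)) hw.

(* Position in w of the step of kind s with 0-based rank i among these. *)
Definition step_pos (s : bool) (w : seq bool) (i : nat) : nat :=
  nth 0 [seq k <- iota 0 (size w) | nth (~~ s) w k == s] i.

Definition num_before (t s : bool) (w : seq bool) (i : nat) : nat :=
  count_mem t (take (step_pos s w i) w).

Section Maps.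
Variable n : nat.
Implicit Types (p q : dyck n) (r s : 'I_n).

Definition height p (i : 'I_n) : nat := num_before North East p i.

Definition Area p : {set 'I_n * 'I_n} :=
  [set ij : 'I_n * 'I_n | (ij.1 < ij.2) && (ij.2 < height p ij.1)].

(* There is one North step, hence one box, in each row: a box is named by its
   0-based row r, and its 0-based column is the abscissa of the North step.  On a
   Dyck path the column is at most the row, so the subtraction is exact. *)
Definition box_col p r : nat := num_before East North p r.

Definition box_diag p r : nat := r - box_col p r.

Definition read_before p r s : bool :=
  (box_diag p r < box_diag p s) ||
  ((box_diag p r == box_diag p s) && (box_col p r < box_col p s)).

Definition label p r : nat := #|[set s | read_before p s r]|.

Definition dinv_attacks p r s : bool :=
  ((label p r < label p s) && (box_diag p r == box_diag p s)) ||
  ((box_diag p s == (box_diag p r).+1) && (box_col p s < box_col p r)).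

Definition attack_set p : {set 'I_n * 'I_n} :=
  [set ij : 'I_n * 'I_n | [exists r, exists s,
     [&& label p r == ij.1, label p s == ij.2 & dinv_attacks p r s]]].

(* The path whose Area is attack_set p exists and is unique, and zeta is a
   bijection, so neither of the default values below is ever reached. *)
Definition zeta p : dyck n := odflt p [pick q | Area q == attack_set p].

Definition zeta_inv q : dyck n := odflt q [pick p | zeta p == q].

Definition rev_word (w : seq bool) : seq bool := map negb (rev w).

Lemma rev_word_dyck (w : seq bool) : is_dyck n w -> is_dyck n (rev_word w).
Proof.
case/and3P=> /eqP cN /eqP cE /allP hw.
have cntN v : count_mem North (rev_word v) = count_mem East v.
  by rewrite /rev_word count_map count_rev; apply: eq_count => -[].
have cntE v : count_mem East (rev_word v) = count_mem North v.
  by rewrite /rev_word count_map count_rev; apply: eq_count => -[].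
rewrite /is_dyck cntN cntE cN cE !eqxx /=; apply/allP => k _.
have -> : take k (rev_word w) = rev_word (drop (size w - k) w).
  by rewrite /rev_word -map_take take_rev.
rewrite cntN cntE.
have /hw : size w - k \in iota 0 (size w).+1 by rewrite mem_iota; lia.
have e t : count_mem t w =
    count_mem t (take (size w - k) w) + count_mem t (drop (size w - k) w).
  by rewrite -count_cat cat_take_drop.
by move: (e North) (e East); rewrite cN cE; lia.
Qed.

Definition rev_dyck p : dyck n := mk_dyck (rev_word_dyck (dyck_wordP p)).

End Maps.

Definition is_partition (la : seq nat) : bool := sorted geq la && (0 \notin la).

Definition wpow (w : seq bool) (k : nat) : seq bool := flatten (nseq k w).

(* With la_(i+1) = nth 0 la i, the middle factors below run over
   i = l-1, ..., 1 where l = size la.  The empty partition gives the empty path. *)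
Definition inv_factor (la : seq nat) (i : nat) : seq bool :=
  wpow [:: East; North] (nth 0 la i)
  ++ wpow [:: North] (nth 0 la i.-1 - nth 0 la i).

Definition quinv_factor (la : seq nat) (i : nat) : seq bool :=
  wpow [:: North] (nth 0 la i.-1 - nth 0 la i)
  ++ wpow [:: East; North] (nth 0 la i).

Definition path_word (factor : nat -> seq bool) (la : seq nat) : seq bool :=
  wpow [:: North] (nth 0 la (size la).-1)
  ++ flatten [seq factor i | i <- rev (iota 1 (size la).-1)]
  ++ wpow [:: East] (nth 0 la 0).

Definition inv_word (la : seq nat) := path_word (inv_factor la) la.

Definition quinv_word (la : seq nat) := path_word (quinv_factor la) la.

Lemma count_wpow t w k : count_mem t (wpow w k) = k * count_mem t w.
Proof. by elim: k => //= k IH; rewrite /wpow /= count_cat -/(wpow w k) IH mulSn. Qed.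

(* Prefix condition for a word read from a point at height h above the diagonal. *)
Definition above_from (h : nat) (w : seq bool) : Prop :=
  forall k, count_mem East (take k w) <= h + count_mem North (take k w).

Lemma above_from_cat h u v :
    above_from h u -> count_mem East u <= count_mem North u ->
  above_from h v -> above_from h (u ++ v).
Proof.
move=> hu le hv k; rewrite take_cat; case: ltnP => _; first exact: hu.
by rewrite !count_cat; move: (hv (k - size u)); lia.
Qed.

Lemma above_from_wpow h w k :
    above_from h w -> count_mem East w <= count_mem North w ->
  above_from h (wpow w k).
Proof.
move=> hw le; elim: k => [|k IH]; first by move=> k; rewrite /wpow /=.
exact: above_from_cat.
Qed.

Lemma above_from_flatten h ws :
    (forall w, w \in ws ->
       above_from h w /\ count_mem East w <= count_mem North w) ->
  above_from h (flatten ws).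
Proof.
elim: ws => [|w ws IH] H /=; first by move=> k.
have [hw le] := H w (mem_head _ _).
by apply: above_from_cat => //; apply: IH => v hv; apply: H; rewrite inE hv orbT.
Qed.

Lemma above_from_N h : above_from h [:: North].
Proof. by case=> [|k] //=; rewrite /East /North /=; lia. Qed.

Lemma above_from_EN h : 0 < h -> above_from h [:: East; North].
Proof. by move=> h0 [|[|k]] //=; rewrite /East /North /=; lia. Qed.

Lemma path_word_dyck factor la :
    is_partition la ->
    (forall i, count_mem North (factor i) =
       nth 0 la i + (nth 0 la i.-1 - nth 0 la i)) ->
    (forall i, count_mem East (factor i) = nth 0 la i) ->
    (forall i h, 0 < h -> above_from h (factor i)) ->
  is_dyck (sumn la) (path_word factor la).
Proof.
case/andP=> so n0 fN fE fab.
have [->|la0] := eqVneq la [::]; first by [].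
have s0 : 0 < size la by rewrite lt0n size_eq0.
have pos : 0 < nth 0 la (size la).-1.
  rewrite lt0n; apply/negP => /eqP e; move/negP: n0; apply.
  by rewrite -[X in X \in _]e mem_nth // prednK.
have le i : 0 < i -> i < size la -> nth 0 la i <= nth 0 la i.-1.
  case: i => //= i _ hi.
  by have /(_ i) := (sortedP 0 so); apply.
have ssum : sumn la = \sum_(0 <= i < size la) nth 0 la i.
  by rewrite sumnE (big_nth 0).
have cf t : count_mem t (flatten [seq factor i | i <- rev (iota 1 (size la).-1)])
   = \sum_(1 <= i < size la) count_mem t (factor i).
  rewrite count_flatten -map_comp sumnE big_map /index_iota subn1.
  by rewrite (perm_big (iota 1 (size la).-1)) ?perm_rev.
have cN : count_mem North (path_word factor la) = sumn la.
  rewrite /path_word !count_cat !count_wpow cf /= /North /East /=.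
  rewrite (eq_big_nat _ _ (F2 := fun i => nth 0 la i.-1)); last first.
    by move=> i /andP[i1 i2]; rewrite fN subnKC // le.
  rewrite ssum big_add1 /= -[in RHS](prednK s0) big_nat_recr //=.
  by lia.
have cE : count_mem East (path_word factor la) = sumn la.
  rewrite /path_word !count_cat !count_wpow cf /= /North /East /=.
  rewrite (eq_big_nat _ _ (F2 := fun i => nth 0 la i)); last by move=> i _; apply: fE.
  rewrite ssum [in RHS]big_ltn //; lia.
rewrite /is_dyck cN cE !eqxx /=; apply/allP => k _.
move: cN cE; rewrite /path_word.
set u := wpow _ _; set v := flatten _; set e := wpow _ _ => cN cE.
have vle : count_mem East v <= count_mem North v.
  by rewrite !cf; apply: leq_sum => i _; rewrite fN fE leq_addr.
have vab : above_from (nth 0 la (size la).-1) v.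
  apply: above_from_flatten => w /mapP[i _ ->]; split; first exact: fab.
  by rewrite fN fE leq_addr.
have uN : count_mem North u = nth 0 la (size la).-1 by rewrite count_wpow /= muln1.
have uE : count_mem East u = 0 by rewrite count_wpow /= muln0.
have uab : above_from 0 u by apply: above_from_wpow => //; apply: above_from_N.
have eN m : count_mem North (take m e) = 0.
  apply/eqP; rewrite -leqn0.
  have -> : 0 = count_mem North e by rewrite count_wpow /= muln0.
  by rewrite -[in X in _ <= X](cat_take_drop m e) count_cat leq_addr.
have eE m : count_mem East (take m e) <= count_mem East e.
  by rewrite -[in X in _ <= X](cat_take_drop m e) count_cat leq_addr.
have eN' : count_mem North e = 0 by rewrite count_wpow /= muln0.
move: cN cE; rewrite !count_cat => cN cE.
rewrite take_cat; case: ltnP => _; first exact: uab.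
rewrite count_cat [X in _ <= X]count_cat take_cat; case: ltnP => _.
  by move: (vab (k - size u)); lia.
by rewrite !count_cat eN; move: (eE (k - size u - size v)); lia.
Qed.

Lemma inv_word_dyck la : is_partition la -> is_dyck (sumn la) (inv_word la).
Proof.
move=> hla; apply: path_word_dyck => // [i|i|i h h0].
- by rewrite count_cat !count_wpow /= /North /East /=; lia.
- by rewrite count_cat !count_wpow /= /North /East /=; lia.
by apply: above_from_cat; rewrite ?count_wpow //;
   apply: above_from_wpow => //; [apply: above_from_EN | apply: above_from_N].
Qed.

Lemma quinv_word_dyck la : is_partition la -> is_dyck (sumn la) (quinv_word la).
Proof.
move=> hla; apply: path_word_dyck => // [i|i|i h h0].
- by rewrite count_cat !count_wpow /= /North /East /=; lia.
- by rewrite count_cat !count_wpow /= /North /East /=; lia.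
by apply: above_from_cat; rewrite ?count_wpow //=; try lia;
   apply: above_from_wpow => //; [apply: above_from_N | apply: above_from_EN].
Qed.

Definition path_inv (la : seq nat) (hla : is_partition la) : dyck (sumn la) :=
  mk_dyck (inv_word_dyck hla).

Definition path_quinv (la : seq nat) (hla : is_partition la) : dyck (sumn la) :=
  mk_dyck (quinv_word_dyck hla).

(* Main.v *)
Require Import Defs.
From mathcomp Require Import all_boot.
From mathcomp Require Import zify.

Set Implicit Arguments.
Unset Strict Implicit.
Unset Printing Implicit Defensive.

(** Record a Dyck path p by its area sequence: the levels (diagonals) of its
    boxes, read from bottom to top.  In a second, word-level description of zeta,
    for d = 0, 1, 2, ... one scans the area sequence and writes North for each
    entry d and East for each entry d - 1; the concatenation of these segments is
    the word of zeta p ([zeta_word]).  The reason is that the East step written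
    for a box r has, among the East steps, the reading label of r as its rank,
    and that the North steps before it come from the boxes of level at most that
    of r and from the boxes one level higher that precede r: beyond the diagonal,
    these are exactly the boxes that r attacks ([rank_sweep_height]).  This shows
    at the same time that zeta is well defined.

    The sweep can be undone.  In an area sequence an entry d + 1 cannot occur
    before an entry d, so every nonempty segment but the first begins with East.
    This tells where to cut the swept word.  The segments, which are the restrictions
    of the area sequence to two consecutive levels, then determine the sequence:
    at a first discrepancy x < y the restriction to y - 1 and y starts with y on
    one side and with y - 1 (or not at all) on the other ([segment_inj]).  Hence
    zeta is injective, and zeta_inv can be computed by exhibiting a preimage
    ([zetaK]).

    The preimage of rev (path_inv la) is a product of triangles N^k E^k, where k
    runs over the parts of the conjugate partition of la in increasing order.
    The restriction of the area sequence of a triangle to the levels d and d + 1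
    is empty, d, or d followed by d + 1, according to whether k <= d, k = d + 1
    or k > d + 1.  As la_d parts of the conjugate exceed d (with la_0 the largest
    part of la), the segment is E^(la_d - la_(d+1)) (EN)^(la_(d+1)), which is what
    reversing the factors of path_inv la gives.  Reversing the product of
    triangles only puts the parts in decreasing order; the segments become
    (EN)^(la_(d+1)) E^(la_d - la_(d+1)), the reversed factors of path_quinv la. *)

(** * Counting steps of a word *)

Section Steps.
Implicit Types (s t : bool) (u v w : seq bool).

(** Together with [split_at_step], this replaces positions in a word by
    factorizations of the word at a step, on which counts are additive. *)
Lemma step_pos_split s u v :
  step_pos s (u ++ s :: v) (count_mem s u) = size u.
Proof.
rewrite /step_pos size_cat iotaD filter_cat nth_cat size_filter.
have -> : count (fun k => nth (~~ s) (u ++ s :: v) k == s) (iota 0 (size u))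
    = count_mem s u.
  rewrite -[in RHS](mkseq_nth (~~ s) u) /mkseq count_map.
  by apply: eq_in_count => k; rewrite mem_iota /= nth_cat => ->.
by rewrite ltnn subnn /= add0n nth_cat ltnn subnn eqxx.
Qed.

Lemma num_before_split t s u v :
  num_before t s (u ++ s :: v) (count_mem s u) = count_mem t u.
Proof. by rewrite /num_before step_pos_split take_size_cat. Qed.

Lemma split_at_step s w i : i < count_mem s w ->
  exists u v, w = u ++ s :: v /\ count_mem s u = i.
Proof.
elim: w i => //= x w IH i; have [->|xs] := eqVneq x s.
  case: i => [_|i]; first by exists [::], w.
  by rewrite ltnS => /IH [u [v [-> <-]]]; exists (s :: u), v; rewrite /= eqxx.
move=> /IH [u [v [-> <-]]]; exists (x :: u), v.
by rewrite /= (negbTE xs).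
Qed.

Lemma num_before_catl t s u v i : i < count_mem s u ->
  num_before t s (u ++ v) i = num_before t s u i.
Proof.
by move=> /split_at_step [u1 [u2 [-> <-]]]; rewrite -catA /= !num_before_split.
Qed.

Lemma num_before_catr t s u v i : i < count_mem s v ->
  num_before t s (u ++ v) (count_mem s u + i) = count_mem t u + num_before t s v i.
Proof.
move=> /split_at_step [v1 [v2 [-> <-]]].
by rewrite catA -count_cat !num_before_split count_cat.
Qed.

Lemma num_before_leS t s w i : i.+1 < count_mem s w ->
  num_before t s w i <= num_before t s w i.+1.
Proof.
move=> /split_at_step [u [v [-> cu]]].
have /split_at_step [u1 [u2 [eu c1]]] : i < count_mem s u by rewrite cu.
by rewrite -cu num_before_split -c1 eu -catA /= num_before_split count_cat leq_addr.
Qed.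

(** At the first discrepancy between the words, the next s comes at once in one
    of them, and only after at least one opposite step in the other. *)
Lemma num_before_inj s w w' :
    count_mem s w = count_mem s w' -> size w = size w' ->
    (forall i, i < count_mem s w ->
      num_before (~~ s) s w i = num_before (~~ s) s w' i) ->
  w = w'.
Proof.
elim: w w' => [|x w IH] [|y w'] //= cs [sz] H.
have first z v : z != s -> 0 < count_mem s v ->
    0 < num_before (~~ s) s (z :: v) 0.
  move=> zs v0; rewrite -cat1s -[X in num_before _ _ _ X]/(0 + 0).
  have {2}<- : count_mem s [:: z] = 0 by rewrite /= (negbTE zs).
  rewrite num_before_catr //=.
  by case: (z) (s) zs => [] [].
have zero v : num_before (~~ s) s (s :: v) 0 = 0.
  by have := num_before_split (~~ s) s [::] v.
have exy : x = y.
  have [xs|xs] := eqVneq x s; have [ys|ys] := eqVneq y s.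
  - by rewrite xs ys.
  - move: cs H; rewrite xs (negbTE ys) eqxx /= add0n => cs /(_ 0 isT).
    by rewrite zero => e; have := first y w' ys; rewrite -e -cs => /(_ isT).
  - move: cs H; rewrite ys (negbTE xs) eqxx /= add0n => cs.
    rewrite cs => /(_ 0 isT).
    by rewrite zero => e; have := first x w xs; rewrite e cs => /(_ isT).
  - by case: (x) (y) (s) xs ys => [] [] [].
rewrite -exy in cs H *; move/addnI: cs => cs; congr cons.
apply: IH => // i hi; have := H ((x == s) + i); rewrite ltn_add2l => /(_ hi).
have -> : (x == s) + i = count_mem s [:: x] + i by rewrite /= addn0.
rewrite -[x :: w]cat1s -[x :: w']cat1s !num_before_catr -?cs //.
by move/addnI.
Qed.

End Steps.

(** * Dyck words *)

Implicit Types u v w : seq bool.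

Lemma dyck_north n w : is_dyck n w -> count_mem North w = n.
Proof. by case/and3P=> /eqP. Qed.

Lemma dyck_east n w : is_dyck n w -> count_mem East w = n.
Proof. by case/and3P=> _ /eqP. Qed.

Lemma dyck_prefix n u v : is_dyck n (u ++ v) -> count_mem East u <= count_mem North u.
Proof.
case/and3P=> _ _ /allP /(_ (size u)); rewrite take_size_cat //; apply.
by rewrite mem_iota size_cat; lia.
Qed.

Lemma dyck_height n w i : is_dyck n w -> i < n -> i < num_before North East w i <= n.
Proof.
move=> dw; rewrite -{1}(dyck_east dw) => /split_at_step [u [v [e <-]]].
have := dyck_north dw; move: dw; rewrite e -cat_rcons => /dyck_prefix.
rewrite cat_rcons num_before_split -cats1 !count_cat /North /East /=; lia.
Qed.

Lemma dyck_col n w r : is_dyck n w -> r < n -> num_before East North w r <= r.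
Proof.
move=> dw; rewrite -{1}(dyck_north dw) => /split_at_step [u [v [e <-]]].
by move: dw; rewrite e num_before_split => /dyck_prefix.
Qed.

(** The path comes closest to the diagonal just after an East step, so it
    suffices to test there. *)
Lemma is_dyck_height n w : count_mem North w = n -> count_mem East w = n ->
  (forall i, i < n -> i < num_before North East w i) -> is_dyck n w.
Proof.
move=> cN cE H; rewrite /is_dyck cN cE !eqxx /=; apply/allP => k _.
case c: (count_mem East (take k w)) => [//|c'].
have hc : c' < count_mem East (take k w) by rewrite c.
have := hc => /split_at_step [u [v [e cu]]].
have hn : c' < n.
  rewrite -cE -(cat_take_drop k w) count_cat c; lia.
have := H _ hn; rewrite -{1}(cat_take_drop k w) num_before_catl //.
rewrite e -{2}cu num_before_split count_cat; lia.
Qed.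

Section Area.
Variable n : nat.
Implicit Types p q : dyck n.

Lemma dyck_inj p q : dyck_word p = dyck_word q :> seq bool -> p = q.
Proof. by move=> e; apply/val_inj/val_inj. Qed.

(** On a Dyck path column i of the area is the interval from i + 1 to
    [height p i - 1], possibly empty; as the height exceeds i, it can be read off
    the area. *)
Lemma Area_inj : injective (@Area n).
Proof.
move=> p q eA; apply: dyck_inj.
have dp := dyck_wordP p; have dq := dyck_wordP q.
apply: (@num_before_inj East); rewrite ?(dyck_east dp) ?(dyck_east dq) //.
  by rewrite !size_tuple.
move=> i hi; rewrite -/(height p (Ordinal hi)) -/(height q (Ordinal hi)).
have le (p1 p2 : dyck n) : Area p1 = Area p2 ->
    height p1 (Ordinal hi) <= height p2 (Ordinal hi).
  move=> e; rewrite leqNgt; apply/negP => lt.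
  have /andP[_ l1] := dyck_height (dyck_wordP p1) hi.
  have /andP[l2 _] := dyck_height (dyck_wordP p2) hi.
  have hj := leq_trans lt l1.
  have /setP/(_ (Ordinal hi, Ordinal hj)) := e.
  by rewrite !inE /= lt ltnn /height l2.
by apply/eqP; rewrite eqn_leq !le.
Qed.

End Area.

(** * The area sequence *)

(** The subtraction is truncated; on a Dyck path it is exact. *)
Definition levels (w : seq bool) : seq nat :=
  mkseq (fun r => r - num_before East North w r) (count_mem North w).

Definition area_step (x y : nat) := y <= x.+1.

(** A North step goes one level up, and the East steps before the next North
    step can only lower the level. *)
Lemma levels_sorted w : sorted area_step (levels w).
Proof.
apply/(sortedP 0) => i; rewrite size_mkseq => hi.
rewrite !nth_mkseq //; last by lia.
by have := num_before_leS East hi; rewrite /area_step; lia.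
Qed.

Lemma levels_le w r : r < count_mem North w -> nth 0 (levels w) r <= r.
Proof. by move=> hr; rewrite nth_mkseq // leq_subr. Qed.

Lemma levels_lt w : all (gtn (count_mem North w)) (levels w).
Proof.
apply/(all_nthP 0) => r; rewrite size_mkseq /= => hr.
by apply: leq_ltn_trans (levels_le hr) _.
Qed.

Lemma levels_cat u v : count_mem North u = count_mem East u ->
  levels (u ++ v) = levels u ++ levels v.
Proof.
move=> e; rewrite /levels /mkseq count_cat iotaD map_cat; congr cat.
  by apply/eq_in_map => r; rewrite mem_iota /= => hr; rewrite num_before_catl.
rewrite add0n -[X in iota X _]addn0 iotaDl -map_comp.
apply/eq_in_map => r; rewrite mem_iota /= => hr.
by rewrite num_before_catr // e subnDl.
Qed.

Lemma levels_inj n (p q : dyck n) : levels p = levels q -> p = q.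
Proof.
have dp := dyck_wordP p; have dq := dyck_wordP q => e; apply: dyck_inj.
apply: (@num_before_inj North); rewrite ?(dyck_north dp) ?(dyck_north dq) //.
  by rewrite !size_tuple.
move=> r hr /=; have := congr1 (nth 0 ^~ r) e.
rewrite /= !nth_mkseq ?(dyck_north dp) ?(dyck_north dq) //.
by have := dyck_col dp hr; have := dyck_col dq hr; rewrite /North /East /=; lia.
Qed.

(** * Sweeping an area sequence *)

Implicit Types (a b : seq nat) (d r s : nat).

(** Level d is written North and level d - 1 is written East.  The test on
    [x.+1] makes segment 0 consist of the North steps of level 0 only. *)
Definition segment (d : nat) (a : seq nat) : seq bool :=
  [seq x == d | x <- a & (x == d) || (x.+1 == d)].

Definition sweep_to (m : nat) (a : seq nat) : seq bool :=
  flatten [seq segment d a | d <- iota 0 m].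

(** The levels of an area sequence are smaller than its size, so the bound
    covers all of them; segments above the top level are empty. *)
Definition sweep (a : seq nat) : seq bool := sweep_to (size a).+1 a.

Lemma segment_cat d a b : segment d (a ++ b) = segment d a ++ segment d b.
Proof. by rewrite /segment filter_cat map_cat. Qed.

Lemma count_segment_north d a : count_mem North (segment d a) = count_mem d a.
Proof.
rewrite count_map count_filter; apply: eq_count => x /=.
by rewrite /North; case: (x == d).
Qed.

Lemma count_segment_east d a :
  count_mem East (segment d a) = count (fun x => x.+1 == d) a.
Proof.
rewrite count_map count_filter; apply: eq_count => x /=.
by rewrite /East; lia.
Qed.

Lemma sweep_toS m a : sweep_to m.+1 a = sweep_to m a ++ segment m a.
Proof.
by rewrite /sweep_to -addn1 iotaD map_cat flatten_cat /= cats0.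
Qed.

Lemma count_ltS (a : seq nat) d : count (gtn d.+1) a = count (gtn d) a + count_mem d a.
Proof. by elim: a => //= x a ->; lia. Qed.

Lemma count_sweep_north m a : count_mem North (sweep_to m a) = count (gtn m) a.
Proof.
elim: m => [|m IH]; first by rewrite /sweep_to /=; elim: a.
by rewrite sweep_toS count_cat IH count_segment_north count_ltS.
Qed.

Lemma count_sweep_east m a : count_mem East (sweep_to m.+1 a) = count (gtn m) a.
Proof.
elim: m => [|m IH].
  by rewrite sweep_toS count_cat count_segment_east /sweep_to /=; elim: a.
by rewrite sweep_toS count_cat IH count_segment_east count_ltS.
Qed.

(** The reading label of the box at index r, see [labelE]: lower levels come
    first, then the boxes of the same level by index. *)
Definition rank (a : seq nat) (r : nat) : nat :=
  count (gtn (nth 0 a r)) a + count_mem (nth 0 a r) (take r a).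

(** The number of North steps written before the East step of the box at index
    r, see [sweep_height_rank]. *)
Definition sweep_height (a : seq nat) (r : nat) : nat :=
  count (gtn (nth 0 a r).+1) a + count_mem (nth 0 a r).+1 (take r a).

Lemma sweep_height_rank a r : r < size a -> nth 0 a r < size a ->
  num_before North East (sweep a) (rank a r) = sweep_height a r.
Proof.
move=> hr; rewrite /rank /sweep_height; set d := nth 0 a r => hd.
(* The East step of r is the one written when the scan for segment d + 1 meets r. *)
have ea : a = take r a ++ d :: drop r.+1 a by rewrite -drop_nth // cat_take_drop.
have -> : sweep a = (sweep_to d.+1 a ++ segment d.+1 (take r a)) ++
    East :: (segment d.+1 (drop r.+1 a)
             ++ flatten [seq segment e a | e <- iota d.+2 (size a - d.+1)]).
  have E : segment d.+1 (d :: drop r.+1 a) = East :: segment d.+1 (drop r.+1 a).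
    by rewrite /segment /= eqxx orbT /= /East; congr cons; lia.
  rewrite -catA -cat_cons -E [segment _ (take _ _) ++ _]catA -segment_cat -ea catA.
  rewrite -sweep_toS /sweep /sweep_to -flatten_cat -map_cat -iotaD.
  by congr (flatten (map _ (iota _ _))); lia.
have -> : count (gtn d) a + count_mem d (take r a) =
    count_mem East (sweep_to d.+1 a ++ segment d.+1 (take r a)).
  by rewrite count_cat count_sweep_east count_segment_east.
by rewrite num_before_split count_cat count_sweep_north count_segment_north.
Qed.

Lemma count_take_lt (a : seq nat) r e : r < size a -> nth 0 a r = e ->
  forall s, (count_mem e (take r a) < count_mem e (take s a)) = (r < s).
Proof.
move=> hr er s.
have mono i j : i <= j -> count_mem e (take i a) <= count_mem e (take j a).
  by move=> ij; rewrite -(subnKC ij) takeD count_cat leq_addr.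
case: (ltnP r s) => rs; last by rewrite ltnNge mono.
apply: leq_trans (mono _ _ rs).
by rewrite (take_nth 0) // -cats1 count_cat er /= eqxx; lia.
Qed.

Lemma count_gtn_mono (a : seq nat) d e : d <= e -> count (gtn d) a <= count (gtn e) a.
Proof. by move=> de; apply: sub_count => x /= xd; apply: leq_trans de. Qed.

Lemma rank_lt_count a r : r < size a -> rank a r < count (gtn (nth 0 a r).+1) a.
Proof.
move=> hr; rewrite count_ltS ltn_add2l -[X in _ < count_mem _ X]take_size.
by rewrite count_take_lt.
Qed.

Lemma rank_lt_level a r s : r < size a -> s < size a ->
  nth 0 a r < nth 0 a s -> rank a r < rank a s.
Proof.
move=> hr hs lt; apply: leq_trans (rank_lt_count hr) _.
by apply: leq_trans (count_gtn_mono a lt) _; apply: leq_addr.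
Qed.

Lemma rank_lt_same a r s : r < size a -> nth 0 a r = nth 0 a s ->
  (rank a r < rank a s) = (r < s).
Proof. by move=> hr e; rewrite /rank -e ltn_add2l count_take_lt. Qed.

(** The rank orders boxes totally, first by level and then by index. *)
Lemma rank_inj a r s : r < size a -> s < size a -> rank a r = rank a s -> r = s.
Proof.
move=> hr hs e; case: (ltngtP (nth 0 a r) (nth 0 a s)) => l.
- by have := rank_lt_level hr hs l; rewrite e ltnn.
- by have := rank_lt_level hs hr l; rewrite e ltnn.
have := rank_lt_same hr l; have := rank_lt_same hs (esym l).
by rewrite e ltnn; lia.
Qed.

(** The cells of the column of a box under the swept path are those of the boxes
    that it attacks: every later box of its level, and, of the level above, the
    boxes that precede it in the area sequence. *)
Lemma rank_sweep_height a r s : r < size a -> s < size a ->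
  (rank a r < rank a s < sweep_height a r) =
  ((rank a r < rank a s) && (nth 0 a r == nth 0 a s)) ||
  ((nth 0 a s == (nth 0 a r).+1) && (s < r)).
Proof.
move=> hr hs; set d := nth 0 a r; set e := nth 0 a s.
have lt_r := rank_lt_count hr; have lt_s := rank_lt_count hs.
case: (ltngtP e d) => [ed|de|ed].
- have := rank_lt_level hs hr ed; lia.
- rewrite (rank_lt_level hr hs de) andbF andTb orFb.
  have [e1|ne] := eqVneq e d.+1.
    by rewrite /sweep_height {1}/rank -/d -/e e1 ltn_add2l count_take_lt.
  have de1 : d.+2 <= e by lia.
  apply/negbTE; rewrite -leqNgt /sweep_height -/d.
  apply: leq_trans (leq_trans _ (count_gtn_mono a de1)) (leq_addr _ _).
  rewrite (count_ltS a d.+1) leq_add2l -[X in _ <= count_mem _ X](cat_take_drop r a).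
  by rewrite count_cat leq_addr.
rewrite ed andbT (ltn_eqF (ltnSn d)) /= orbF.
by rewrite (leq_trans lt_s) ?andbT // /sweep_height -/d -/e ed leq_addr.
Qed.

(** * The zeta map is the sweep *)

Lemma card_count_take n (a : seq nat) (P : pred nat) r : size a = n -> r <= n ->
  #|[set s : 'I_n | (s < r) && P (nth 0 a s)]| = count P (take r a).
Proof.
move=> sa rn; rewrite -sum1_card.
rewrite (eq_bigl (fun s : 'I_n => (s < r) && P (nth 0 a s))); last first.
  by move=> s; rewrite inE.
rewrite -(big_mkord (fun s => (s < r) && P (nth 0 a s)) (fun=> 1)) sum1_count.
rewrite /index_iota subn0 -(subnKC rn) iotaD count_cat.
rewrite [X in _ + X](_ : _ = 0) ?addn0.
  rewrite -[in RHS](mkseq_nth 0 (take r a)) count_map size_takel ?sa //.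
  by apply: eq_in_count => i; rewrite mem_iota /= => ir; rewrite ir nth_take.
apply/eqP; rewrite -leqn0 leqNgt -has_count; apply/hasPn => i.
by rewrite mem_iota; lia.
Qed.

Section Zeta.
Variable n : nat.
Implicit Types p q : dyck n.

Lemma size_levels p : size (levels p) = n.
Proof. by rewrite size_mkseq (dyck_north (dyck_wordP p)). Qed.

Lemma nth_levels p (r : 'I_n) : nth 0 (levels p) r = box_diag p r.
Proof. by rewrite nth_mkseq // (dyck_north (dyck_wordP p)). Qed.

Lemma box_col_diag p (r : 'I_n) : box_col p r + box_diag p r = r.
Proof. by rewrite subnKC // (dyck_col (dyck_wordP p)). Qed.

Lemma labelE p (r : 'I_n) : label p r = rank (levels p) r.
Proof.
have sl := size_levels p.
rewrite /rank -[X in count (gtn _) X]take_size sl.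
rewrite -!(card_count_take _ sl) ?(ltnW (ltn_ord r)) //.
rewrite -cardsUI [X in _ + X](_ : _ = 0) ?addn0.
  apply: eq_card => s; rewrite !inE !nth_levels ltn_ord /read_before /=.
  have := box_col_diag p s; have := box_col_diag p r; lia.
by apply/eqP; rewrite cards_eq0; apply/eqP/setP => s; rewrite !inE /=; lia.
Qed.

Lemma label_inj p (r s : 'I_n) : label p r = label p s -> r = s.
Proof.
rewrite !labelE => e; apply: val_inj.
by apply: rank_inj e; rewrite size_levels ltn_ord.
Qed.

(** An injective map from 'I_n to itself is onto. *)
Lemma label_surj p i : i < n -> exists r : 'I_n, label p r = i.
Proof.
move=> hi; have lt (r : 'I_n) : label p r < n.
  rewrite labelE; have := leq_trans (@rank_lt_count (levels p) r _) (count_size _ _).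
  by rewrite size_levels; apply.
have inj : injective (fun r : 'I_n => Ordinal (lt r)).
  by move=> r s [/label_inj].
have [g _ gK] := injF_bij inj; exists (g (Ordinal hi)).
by have := congr1 val (gK (Ordinal hi)).
Qed.

Lemma sweep_height_label p (r : 'I_n) :
  num_before North East (sweep (levels p)) (label p r) = sweep_height (levels p) r.
Proof.
rewrite labelE; apply: sweep_height_rank; rewrite size_levels //.
by apply: leq_ltn_trans (ltn_ord r); apply: levels_le; rewrite (dyck_north (dyck_wordP p)).
Qed.

Lemma count_levels_gtn p m : n <= m -> count (gtn m) (levels p) = n.
Proof.
move=> nm; apply/eqP; rewrite -[X in _ == X](size_levels p) -all_count.
have := levels_lt p; rewrite (dyck_north (dyck_wordP p)).
by apply: sub_all => x /= /leq_trans; apply.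
Qed.

(** The East step of a box comes after the North steps of all boxes of level at
    most its own, and these include the box itself and all boxes with a smaller
    label. *)
Lemma sweep_dyck p : is_dyck n (sweep (levels p)).
Proof.
apply: is_dyck_height; rewrite /sweep ?size_levels.
- by rewrite count_sweep_north count_levels_gtn.
- by rewrite count_sweep_east count_levels_gtn.
move=> i /(label_surj p) [r <-].
have := sweep_height_label p r; rewrite /sweep size_levels => ->; rewrite labelE.
by apply: leq_trans (rank_lt_count _) (leq_addr _ _); rewrite size_levels.
Qed.

Lemma Area_sweep p : Area (mk_dyck (sweep_dyck p)) = attack_set p.
Proof.
apply/setP => -[i j]; rewrite !inE /=.
have [r er] := label_surj p (ltn_ord i); have [s es] := label_surj p (ltn_ord j).
have attacks : (i < j < height (mk_dyck (sweep_dyck p)) i) = dinv_attacks p r s.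
  rewrite /height -er -es sweep_height_label !labelE rank_sweep_height ?size_levels //.
  rewrite /dinv_attacks -!labelE !nth_levels; congr (_ || _).
  (* Columns and indices compare alike here, except that s in the column just
     left of r, one level higher, would be in the row of r. *)
  have [->|] := eqVneq r s; first by lia.
  by rewrite -val_eqE /=; have := box_col_diag p s; have := box_col_diag p r; lia.
rewrite attacks; apply/idP/existsP => [at_rs|[r' /existsP[s' /and3P[/eqP er' /eqP es']]]].
  by exists r; apply/existsP; exists s; rewrite er es !eqxx.
by rewrite (label_inj (etrans er (esym er'))) (label_inj (etrans es (esym es'))).
Qed.

(** The sweep provides a path with the required area, so the default value in
    the definition of zeta is not reached. *)
Lemma zeta_word p : zeta p = sweep (levels p) :> seq bool.
Proof.
rewrite /zeta; case: pickP => [q /eqP|/(_ (mk_dyck (sweep_dyck p)))].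
  by rewrite -Area_sweep => /Area_inj ->.
by rewrite Area_sweep eqxx.
Qed.

End Zeta.

(** * Injectivity of the sweep *)

(** An area sequence climbs by at most one at a time, so from x < d it reaches
    d - 1 before d: the first step recorded is East. *)
Lemma segment_head x a d : path area_step x a -> x < d ->
  ~~ head East (segment d (x :: a)).
Proof.
rewrite /segment; elim: a x => [|y a IH] x pa xd /=.
  by rewrite (ltn_eqF xd); case: eqP => //= _; rewrite (ltn_eqF xd).
rewrite (ltn_eqF xd) /=; case: eqP => [_|nd] /=; first by rewrite (ltn_eqF xd).
by case/andP: pa; rewrite /area_step => xy pa; apply: IH pa _; lia.
Qed.

(** Reading both sequences in parallel, suppose that they first differ by
    entries x < y.  The remaining restrictions to levels y - 1 and y then start
    with North on the side of y, but not on the side of x. *)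
Lemma segment_inj a b : sorted area_step a -> sorted area_step b ->
  (forall d, segment d a = segment d b) -> a = b.
Proof.
have neq x y c c' : path area_step x c -> x < y ->
    segment y (x :: c) <> segment y (y :: c').
  move=> pc xy; rewrite {2}/segment /= eqxx /= => /(congr1 (head East)) /=.
  by rewrite eqxx; have := segment_head pc xy; case: head.
elim: a b => [|x a IH] [|y b] //= sa sb H.
- by have := H y; rewrite /segment /= eqxx.
- by have := H x; rewrite /segment /= eqxx.
case: (ltngtP x y) => xy.
- by case: (neq _ _ _ b sa xy (H y)).
- by case: (neq _ _ _ a sb xy (esym (H x))).
rewrite xy in H sa *; congr cons; apply: IH => [||d].
- exact: path_sorted sa.
- exact: path_sorted sb.
by have := H d; rewrite /segment /=; case: ifP => //= _ [].
Qed.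

(** The left factor ends just before the first East step in excess of its
    count, whichever word it comes from. *)
Lemma cat_east_inj u u' v v' :
    u ++ v = u' ++ v' -> count_mem East u = count_mem East u' ->
    ~~ head East v -> ~~ head East v' ->
  u = u' /\ v = v'.
Proof.
have nil x w z z' : z = x :: w ++ z' -> 0 = count_mem East (x :: w) ->
   ~~ head East z -> False by move=> ->; case: x.
elim: u u' => [|x u IH] [|x' u'] //.
- by move=> e c h _; case: (nil _ _ _ _ e c h).
- by move=> e c _ h; case: (nil _ _ _ _ (esym e) (esym c) h).
by move=> /= [-> e] /addnI c h h'; have [-> ->] := IH _ e c h h'.
Qed.

Lemma flatten_segment_head a m k : sorted area_step a -> head 0 a = 0 ->
  ~~ head East (flatten [seq segment d a | d <- iota m.+1 k]).
Proof.
move=> sa a0; elim: k m => //= k IH m.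
have : ~~ head East (segment m.+1 a).
  by case: a sa a0 {IH} => //= x a pa x0; apply: segment_head pa _; rewrite x0.
by case: (segment _ a) => //= _; apply: IH.
Qed.

Lemma sweep_inj a b :
    sorted area_step a -> head 0 a = 0 -> all (gtn (size a)) a ->
    sorted area_step b -> head 0 b = 0 -> all (gtn (size b)) b ->
    size a = size b -> sweep a = sweep b ->
  a = b.
Proof.
move=> sa a0 alla sb b0 allb sab; rewrite /sweep -sab => e.
have H k m : count_mem East (segment m a) = count_mem East (segment m b) ->
    flatten [seq segment d a | d <- iota m k] =
    flatten [seq segment d b | d <- iota m k] ->
    forall d, m <= d < m + k -> segment d a = segment d b.
  elim: k m => [|k IH] m ce /=; first by lia.
  move=> fe d md.
  (* Segment m + 1 has an East step for each North step of segment m, so equality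
     of segments m supplies the count needed to cut off segments m + 1. *)
  have [em fe'] := cat_east_inj fe ce
    (flatten_segment_head m k sa a0) (flatten_segment_head m k sb b0).
  have [->|nmd] := eqVneq d m; first by [].
  apply: (IH m.+1) => //; last by lia.
  have := congr1 (count_mem North) em.
  by rewrite !count_segment_north !count_segment_east.
apply: segment_inj => // d; case: (leqP d (size a)) => hd.
  apply: (H _ _ _ e); last by lia.
  have c0 c : count_mem East (segment 0 c) = 0.
    by rewrite count_segment_east; elim: c.
  by rewrite !c0.
have big (c : seq nat) : all (gtn (size c)) c -> size c < d -> segment d c = [::].
  move=> /allP hc cd; rewrite /segment; apply/eqP; rewrite -size_eq0 size_map size_filter.
  rewrite -leqn0 leqNgt -has_count; apply/hasPn => x /hc /=; lia.
by rewrite !big // -sab.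
Qed.

Lemma zeta_inj n : injective (@zeta n).
Proof.
move=> p q e; apply: levels_inj.
have lt (p1 : dyck n) : all (gtn (size (levels p1))) (levels p1).
  by rewrite size_mkseq; apply: levels_lt.
have h0 (p1 : dyck n) : head 0 (levels p1) = 0.
  by rewrite -nth0 /levels /mkseq; case: count.
apply: sweep_inj; rewrite ?levels_sorted ?h0 ?lt ?size_levels //.
by rewrite -!zeta_word e.
Qed.

Lemma zetaK n (p : dyck n) : zeta_inv (zeta p) = p.
Proof.
rewrite /zeta_inv; case: pickP => [q /eqP /zeta_inj //|/(_ p)].
by rewrite eqxx.
Qed.

(** * Products of triangles *)

Definition triangles (ks : seq nat) : seq bool :=
  flatten [seq nseq k North ++ nseq k East | k <- ks].

Lemma count_triangles t ks : count_mem t (triangles ks) = sumn ks.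
Proof.
elim: ks => //= k ks; rewrite /triangles /= => IH.
by rewrite !count_cat IH !count_nseq; case: t {IH} => /=; lia.
Qed.

Lemma triangles_dyck n ks : sumn ks = n -> is_dyck n (triangles ks).
Proof.
move=> <-; rewrite /is_dyck !count_triangles !eqxx /=; apply/allP => i _.
elim: ks i => //= k ks IH i; rewrite /triangles /= take_cat.
case: ifP => _; last first.
  rewrite !count_cat !count_nseq /= /North /East /=.
  have := IH (i - size (nseq k North ++ nseq k East)).
  rewrite /triangles /North /East; lia.
rewrite take_cat size_nseq; case: ifP => ik.
  by rewrite take_nseq ?(ltnW ik) // !count_nseq.
rewrite !count_cat !count_nseq /= mul0n mul1n add0n.
apply: leq_trans (leq_addr _ _).
have: count_mem East (take (i - k) (nseq k East)) <= count_mem East (nseq k East).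
  by rewrite -[X in _ <= count_mem _ X](cat_take_drop (i - k)) count_cat leq_addr.
by rewrite count_nseq /= mul1n.
Qed.

Lemma rev_word_cat u v : rev_word (u ++ v) = rev_word v ++ rev_word u.
Proof. by rewrite /rev_word rev_cat map_cat. Qed.

Lemma rev_triangles ks : rev_word (triangles ks) = triangles (rev ks).
Proof.
have catE xs ys : triangles (xs ++ ys) = triangles xs ++ triangles ys.
  by rewrite /triangles map_cat flatten_cat.
elim: ks => //= k ks IH.
rewrite rev_cons -cats1 -cat1s !catE rev_word_cat IH; congr cat.
by rewrite /triangles /= cats0 rev_word_cat /rev_word !rev_nseq !map_nseq.
Qed.

(** In N^k E^k the North steps start at levels 0, 1, ..., k - 1. *)
Lemma levels_triangles ks : levels (triangles ks) = flatten [seq iota 0 k | k <- ks].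
Proof.
elim: ks => //= k ks IH; rewrite /triangles /= levels_cat.
  rewrite -IH; congr cat; rewrite /levels count_cat !count_nseq /= mul1n mul0n addn0.
  rewrite -[RHS]map_id; apply/eq_in_map => r; rewrite mem_iota add0n /= => hr.
  rewrite num_before_catl ?count_nseq /= ?mul1n //.
  have := num_before_split East North (nseq r North) (nseq (k - r).-1 North).
  rewrite !count_nseq /= mul1n mul0n -[North :: _]/(nseq (k - r).-1.+1 North) -nseqD.
  by rewrite (_ : r + _ = k) => [->|]; rewrite ?subn0 //; lia.
by rewrite !count_cat !count_nseq /=; lia.
Qed.

Lemma segment_iotaS d k :
  segment d.+1 (iota 0 k) = nseq (d < k) East ++ nseq (d.+1 < k) North.
Proof.
elim: k => // k IH; rewrite -[k.+1]addn1 iotaD segment_cat IH add0n.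
rewrite /segment [iota _ 1]/= [filter _ _]/= eqSS.
have [->|kd] := eqVneq k d.
  have [-> -> -> ->] : [/\ (d < d) = false, (d.+1 < d) = false,
    (d < d + 1) = true & (d.+1 < d + 1) = false] by split; lia.
  by rewrite orbT /= (ltn_eqF (ltnSn d)).
have [->|kd'] := eqVneq k d.+1.
  have [-> -> -> ->] : [/\ (d < d.+1) = true, (d.+1 < d.+1) = false,
    (d < d.+1 + 1) = true & (d.+1 < d.+1 + 1) = true] by split; lia.
  by rewrite /= eqxx.
by rewrite cats0; congr (nseq _ _ ++ nseq _ _); lia.
Qed.

Lemma segment0_iota k : segment 0 (iota 0 k) = nseq (0 < k) North.
Proof.
case: k => //= k; rewrite /segment /=; congr cons.
by rewrite -[1]addn0 iotaDl filter_map -map_comp (eq_filter (a2 := pred0)) ?filter_pred0.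
Qed.

Lemma segment_flatten d (f : nat -> seq nat) ks :
  segment d (flatten [seq f k | k <- ks]) = flatten [seq segment d (f k) | k <- ks].
Proof. by elim: ks => //= k ks IH; rewrite segment_cat IH. Qed.

(** * The conjugate partition *)

Definition conj_part (la : seq nat) : seq nat :=
  [seq count (ltn c) la | c <- iota 0 (nth 0 la 0)].

(** The defining property of the conjugate partition: both sides say that the
    cell (c, e) lies in the Young diagram of la. *)
Lemma count_ltn_nth la c e : sorted geq la ->
  (e < count (ltn c) la) = (c < nth 0 la e).
Proof.
elim: la e => [|x la IH] e; first by rewrite nth_nil.
move=> sx; have sla : sorted geq la := path_sorted sx.
have yx i : nth 0 la i <= x.
  have [hi|hi] := ltnP i (size la); last by rewrite nth_default.
  have /allP : all (geq x) la.
    move: sx; rewrite /= path_sortedE; first by case/andP.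
    by move=> b a d ab bd; apply: leq_trans bd ab.
  by apply; apply: mem_nth.
rewrite /=; case: (ltnP c x) => cx; case: e => [|e] //=; rewrite ?add1n ?ltnS ?IH //.
  by have := yx 0; lia.
by have := yx e; have := yx e.+1; lia.
Qed.

Lemma nth_geq la i j : sorted geq la -> i <= j -> nth 0 la j <= nth 0 la i.
Proof.
move=> sla ij; rewrite leqNgt -(count_ltn_nth (nth 0 la i)) // -leqNgt.
rewrite leqNgt; apply/negP => h.
have : i < count (ltn (nth 0 la i)) la by apply: leq_ltn_trans h.
by rewrite count_ltn_nth // ltnn.
Qed.

Lemma sumn_conj_part la : sorted geq la -> sumn (conj_part la) = sumn la.
Proof.
move=> sla; rewrite /conj_part; set m := nth 0 la 0.
(* The largest part may be replaced by any bound m on the parts, which makes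
   the induction on la possible. *)
have : all (geq m) la.
  by apply/(all_nthP 0) => i _ /=; apply: nth_geq.
move: m => m {sla}; elim: la => /= [|x la IH].
  by move=> _; elim: (iota 0 m).
case/andP=> xm /IH <-.
(* The part x adds one to the counts of index c < x. *)
rewrite -[x in x + _](_ : sumn [seq nat_of_bool (c < x) | c <- iota 0 m] = x).
  by elim: (iota 0 m) => //= c cs ->; lia.
rewrite -(subnKC xm) iotaD map_cat sumn_cat add0n.
have -> : [seq nat_of_bool (c < x) | c <- iota 0 x] = nseq x 1.
  apply: (@eq_from_nth _ 0) => [|i]; rewrite size_map size_iota ?size_nseq // => hi.
  by rewrite (nth_map 0) ?size_iota // nth_iota // nth_nseq hi.
have -> : [seq nat_of_bool (c < x) | c <- iota x (m - x)] = nseq (m - x) 0.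
  apply: (@eq_from_nth _ 0) => [|i]; rewrite size_map size_iota ?size_nseq // => hi.
  rewrite (nth_map 0) ?size_iota // nth_iota // nth_nseq hi; lia.
by rewrite !sumn_nseq; lia.
Qed.

(** * Sweeping triangles whose sizes form the conjugate partition *)

(** Index c of the conjugate contributes EN, E or nothing according to the
    position of c with respect to the parts la_(d+1) <= la_d. *)
Lemma conj_part_segments la d : sorted geq la ->
  [seq segment d.+1 (iota 0 k) | k <- conj_part la] =
  nseq (nth 0 la d.+1) [:: East; North] ++
  nseq (nth 0 la d - nth 0 la d.+1) [:: East] ++
  nseq (nth 0 la 0 - nth 0 la d) [::].
Proof.
move=> sla; have le1 := nth_geq sla (leqnSn d); have le0 := nth_geq sla (leq0n d).
rewrite -map_comp; apply: (@eq_from_nth _ [::]) => [|c].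
  by rewrite !size_cat !size_nseq size_map size_iota; lia.
rewrite size_map size_iota => hc; rewrite (nth_map 0) ?size_iota // nth_iota //=.
rewrite add0n segment_iotaS !count_ltn_nth // !nth_cat !size_nseq !nth_nseq.
case: (ltnP c (nth 0 la d.+1)) => h1; first by rewrite (leq_trans h1 le1).
rewrite ltn_sub2rE // cats0; case: (ltnP c (nth 0 la d)) => //= h2.
by case: ifP.
Qed.

Lemma conj_part_segment0 la : sorted geq la ->
  [seq segment 0 (iota 0 k) | k <- conj_part la] = nseq (nth 0 la 0) [:: North].
Proof.
move=> sla; rewrite -map_comp; apply: (@eq_from_nth _ [::]) => [|c].
  by rewrite size_nseq size_map size_iota.
rewrite size_map size_iota => hc; rewrite (nth_map 0) ?size_iota // nth_iota //=.
by rewrite add0n segment0_iota count_ltn_nth // hc nth_nseq hc.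
Qed.

Lemma flatten_nil_nseq k : flatten (nseq k [::]) = [::] :> seq bool.
Proof. by elim: k. Qed.

Lemma rev_flatten ws :
  rev_word (flatten ws) = flatten [seq rev_word w | w <- rev ws].
Proof.
elim: ws => //= w ws IH.
by rewrite rev_word_cat IH rev_cons map_rcons flatten_rcons.
Qed.

Lemma rev_wpow w k : rev_word (wpow w k) = wpow (rev_word w) k.
Proof. by rewrite rev_flatten rev_nseq map_nseq. Qed.

(** The initial North run of a path word reads like one more factor, of index
    size la; beyond it the factors are empty, so any upper bound m will do. *)
Lemma rev_path_word factor la m : size la <= m ->
    (forall i, size la <= i -> factor i = wpow [:: North] (nth 0 la i.-1)) ->
  rev_word (path_word factor la) =
  wpow [:: North] (nth 0 la 0) ++ flatten [seq rev_word (factor i) | i <- iota 1 m].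
Proof.
move=> lm H; rewrite /path_word !rev_word_cat !rev_wpow -catA; congr cat.
have tail i k : size la < i -> flatten [seq rev_word (factor j) | j <- iota i k] = [::].
  elim: k i => //= k IH i hi; rewrite IH ?(leqW hi) // H; last by apply: ltnW.
  by rewrite nth_default //; lia.
rewrite rev_flatten -map_rev revK -map_comp.
case: (posnP (size la)) => [s0|s0].
  rewrite s0 /= nth_default ?s0 // /wpow /=.
  by symmetry; apply: tail; rewrite s0.
have -> : m = (size la).-1 + (m - size la).+1 by lia.
rewrite iotaD map_cat flatten_cat; congr cat.
by rewrite /= add1n prednK // H // rev_wpow tail // cats0.
Qed.

Section Main.
Variables (la : seq nat) (hla : is_partition la).

Let sorted_la : sorted geq la.
Proof. by case/andP: hla. Qed.

Lemma partition_size_le : size la <= sumn la.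
Proof.
case/andP: hla => _; elim: (la) => //= x xs IH; rewrite inE negb_or => /andP[x0 /IH].
by rewrite eq_sym in x0; lia.
Qed.

(** Segment d + 1 is matched with the reversed factor of index d + 1.  Factors
    of index greater than the number of parts are empty, and there are at most
    [sumn la] parts, so the sweep covers all the nonempty ones. *)
Lemma sweep_rev_path factor ks :
    perm_eq ks (conj_part la) ->
    (forall i, size la <= i -> factor i = wpow [:: North] (nth 0 la i.-1)) ->
    flatten [seq segment 0 (iota 0 k) | k <- ks] = wpow [:: North] (nth 0 la 0) ->
    (forall d, flatten [seq segment d.+1 (iota 0 k) | k <- ks] = rev_word (factor d.+1)) ->
  sweep (levels (triangles ks)) = rev_word (path_word factor la).
Proof.
move=> ek fl s0 s1; rewrite (rev_path_word partition_size_le fl).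
rewrite levels_triangles /sweep /sweep_to.
have -> : size (flatten [seq iota 0 k | k <- ks]) = sumn la.
  rewrite -(sumn_conj_part sorted_la) -(perm_sumn ek) size_flatten /shape -map_comp.
  by congr sumn; rewrite -[RHS]map_id; apply: eq_map => k /=; rewrite size_iota.
rewrite /= segment_flatten s0 (iotaDl 1 0) -!map_comp; congr (_ ++ flatten _).
by apply: eq_map => d; rewrite /= segment_flatten s1.
Qed.

Lemma triangles_conj_dyck : is_dyck (sumn la) (triangles (conj_part la)).
Proof. by apply: triangles_dyck; rewrite sumn_conj_part. Qed.

Lemma zeta_conj_quinv :
  zeta (mk_dyck triangles_conj_dyck) = rev_dyck (path_quinv hla).
Proof.
apply: dyck_inj; rewrite zeta_word; apply: sweep_rev_path => // [i hi||d].
- rewrite /quinv_factor (nth_default _ hi) subn0; exact: cats0.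
- by rewrite conj_part_segment0.
rewrite conj_part_segments // /quinv_factor rev_word_cat !rev_wpow.
by rewrite !flatten_cat flatten_nil_nseq cats0.
Qed.

Lemma zeta_rev_conj_inv :
  zeta (rev_dyck (mk_dyck triangles_conj_dyck)) = rev_dyck (path_inv hla).
Proof.
apply: dyck_inj; rewrite zeta_word [LHS]/= rev_triangles.
apply: sweep_rev_path => [|i hi||d].
- by rewrite perm_rev.
- by rewrite /inv_factor (nth_default _ hi) subn0.
- by rewrite map_rev conj_part_segment0 // rev_nseq.
rewrite map_rev conj_part_segments // /inv_factor rev_word_cat !rev_wpow.
by rewrite !rev_cat !rev_nseq !flatten_cat flatten_nil_nseq.
Qed.

End Main.

Lemma rev_dyckK n : involutive (@rev_dyck n).
Proof.
move=> p; apply: dyck_inj; rewrite /= /rev_word -map_rev revK -map_comp.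
by rewrite -[RHS]map_id; apply: eq_map => x /=; rewrite negbK.
Qed.

Theorem corollary2p5 (la : seq nat) (hla : is_partition la) :
  rev_dyck (zeta (rev_dyck (zeta_inv (rev_dyck (path_inv hla)))))
  = path_quinv hla.
Proof. by rewrite -zeta_rev_conj_inv zetaK rev_dyckK zeta_conj_quinv rev_dyckK. Qed.
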